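(* For each integer $n\geqslant 1$ let $B_n = 2 + 2\cos\left(\frac{2\pi}{n}\right)$ be the $n$-th Beraha number. The only Beraha numbers that are chromatic roots are the integer Beraha numbers $B_1 = 4$, $B_2 = 0$, $B_3 = 1$, $B_4 = 2$, $B_6 = 3$, and the number $B_{10} = (5+\sqrt{5})/2$. That is, the set of Beraha numbers $B_n$ ($n \geqslant 1$) for which there exists a finite simple graph $G$ with $P_G(B_n) = 0$ is exactly $\{B_1, B_2, B_3, B_4, B_6, B_{10}\}$.
   Context: For a finite simple graph $G$, the chromatic polynomial $P_G$ is the unique polynomial such that $P_G(q)$ equals the number of proper $q$-colourings of $G$ for every non-negative integer $q$. A chromatic root is a (real or complex) number that is a root of $P_G$ for some finite simple graph $G$. *)

(* Defs.v *)
From HB Require Import structures.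
From mathcomp Require Import all_boot all_order all_algebra.
From mathcomp Require Import boolp classical_sets reals trigo.

Set Implicit Arguments.
Unset Strict Implicit.
Unset Printing Implicit Defensive.

Import Order.TTheory GRing.Theory Num.Theory.

Local Open Scope ring_scope.

Record simple_graph := SimpleGraph {
  vertex :> finType;
  adj : rel vertex;
  adj_sym : symmetric adj;
  adj_irr : irreflexive adj }.

Definition proper_colouring (G : simple_graph) (q : nat)
    (c : {ffun G -> 'I_q}) : bool :=
  [forall x, forall y, adj x y ==> (c x != c y)].

Definition num_colourings (G : simple_graph) (q : nat) : nat :=
  #|[set c : {ffun G -> 'I_q} | proper_colouring c]|.

(* Existence of the chromatic polynomial is deletion-contraction on a list D of
   edges; instead of contracting an edge, we move it to the list A of pairs
   whose endpoints must receive equal colours. *)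
Section Existence.

Variable T : finType.

Let equal_on q (A : seq (T * T)) (c : {ffun T -> 'I_q}) :=
  all (fun p => c p.1 == c p.2) A.
Let distinct_on q (D : seq (T * T)) (c : {ffun T -> 'I_q}) :=
  all (fun p => c p.1 != c p.2) D.

Lemma card_equal_on (A : seq (T * T)) :
  exists k, forall q,
    #|[set c : {ffun T -> 'I_q} | equal_on A c]| = (q ^ k)%N.
Proof.
pose e : rel T := fun x y => ((x, y) \in A) || ((y, x) \in A).
have es : connect_sym e by apply: sym_connect_sym => x y; rewrite /e orbC.
pose r x : {x | roots e x} := exist _ (fingraph.root e x) (roots_root es x).
exists #|{: {x | roots e x}}| => q.
pose h (g : {ffun {x | roots e x} -> 'I_q}) : {ffun T -> 'I_q} :=
  [ffun x => g (r x)].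
have rK (s : {x | roots e x}) : r (val s) = s.
  by apply: val_inj => /=; apply/eqP/(valP s).
have hinj : injective h.
  move=> g g' E; apply/ffunP => s.
  have := congr1 (fun c : {ffun T -> 'I_q} => c (val s)) E.
  by rewrite /= !ffunE rK.
have -> : [set c : {ffun T -> 'I_q} | equal_on A c] = h @: predT.
  apply/setP => c; rewrite inE; apply/idP/imsetP.
    move=> /allP cA; exists [ffun s => c (val s)] => //.
    apply/ffunP => x; rewrite !ffunE /=.
    have /connectP[p + ->] := connect_root e x.
    elim: p x => //= y p IH x /andP[exy /IH <-].
    by case/orP: exy => /cA /= /eqP.
  move=> [g _ ->]; apply/allP => -[x y] xyA /=; rewrite !ffunE.
  suff -> : r x = r y by [].
  by apply: val_inj => /=; apply/(fingraph.rootP es)/connect1; rewrite /e xyA.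
by rewrite card_imset// card_ffun card_ord.
Qed.

Lemma card_constraints (A D : seq (T * T)) :
  exists p : {poly int}, forall q : nat,
    p.[q%:Z] = #|[set c : {ffun T -> 'I_q} | equal_on A c && distinct_on D c]|%:Z.
Proof.
elim: D A => [|d D IH] A.
  have [k kP] := card_equal_on A.
  exists 'X^k => q; rewrite hornerXn -natz -natrX natz -kP.
  by congr (_%:Z); apply: eq_card => c; rewrite !inE andbT.
have [p1 p1P] := IH A; have [p2 p2P] := IH (d :: A).
exists (p1 - p2) => q; rewrite hornerD hornerN p1P p2P.
rewrite -[X in X%:Z - _](cardsID [set c : {ffun T -> 'I_q} | c d.1 == c d.2]).
rewrite PoszD addrAC -[RHS]add0r; congr (_ + _).
  apply/eqP; rewrite subr_eq0; apply/eqP; congr (_%:Z).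
  by apply: eq_card => c; rewrite !inE /= andbC andbA.
by congr (_%:Z); apply: eq_card => c; rewrite !inE /= andbCA.
Qed.

End Existence.

Lemma chromatic_poly_exists (G : simple_graph) :
  exists p : {poly int}, forall q : nat, p.[q%:Z] = (num_colourings G q)%:Z.
Proof.
have [p pP] := card_constraints [::] [seq d <- enum {: G * G} | adj d.1 d.2].
exists p => q; rewrite pP; congr (_%:Z); apply: eq_card => c; rewrite !inE /=.
apply/allP/'forall_forallP => [H x y|H [x y]].
  by apply/implyP => xy; apply: (H (x, y)); rewrite mem_filter mem_enum xy.
by rewrite mem_filter => /andP[/= xy _]; apply: (implyP (H x y)).
Qed.

Definition chromatic_poly (G : simple_graph) : {poly int} :=
  sval (cid (chromatic_poly_exists G)).

Lemma chromatic_polyE (G : simple_graph) (q : nat) :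
  (chromatic_poly G).[q%:Z] = (num_colourings G q)%:Z.
Proof. exact: (svalP (cid (chromatic_poly_exists G))). Qed.

Lemma chromatic_poly_unique (F : numFieldType) (G : simple_graph)
    (p : {poly F}) :
  (forall q : nat, p.[q%:R] = (num_colourings G q)%:R) ->
  p = map_poly intr (chromatic_poly G).
Proof.
move=> pP; apply/eqP; rewrite -subr_eq0; apply/eqP.
set r := _ - _.
apply: (@roots_geq_poly_eq0 _ r [seq i%:R | i <- iota 0 (size r)]).
- apply/allP => _ /mapP[i _ ->]; rewrite rootE hornerD hornerN pP.
  by rewrite -[i%:R](rmorph_nat (intr : int -> F)) horner_map/= natz
             chromatic_polyE -natz rmorph_nat subrr.
- by rewrite map_inj_uniq ?iota_uniq//; exact: mulrIn (oner_neq0 F).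
- by rewrite size_map size_iota.
Qed.

(* A numFieldType may be real or complex. *)
Definition chromatic_root (F : numFieldType) (x : F) : Prop :=
  exists G : simple_graph, root (map_poly intr (chromatic_poly G)) x.

Definition beraha (R : realType) (n : nat) : R :=
  2 + 2 * cos (2 * pi / n%:R).

(* Main.v *)
Require Import Defs.
From mathcomp Require Import all_boot all_order all_algebra.
From mathcomp Require Import boolp classical_sets reals trigo.
From mathcomp Require Import all_field ring lra zify complex.

Import Order.TTheory GRing.Theory Num.Theory.

Local Open Scope classical_set_scope.
Local Open Scope ring_scope.

Set Implicit Arguments.
Unset Strict Implicit.
Unset Printing Implicit Defensive.

(** Three facts combine.

    A chromatic polynomial has integer coefficients, so its roots are closed
    under Galois conjugation.  With z = exp(2 i pi / n), the Beraha number B_n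
    is 2 + z + z^-1, and the irreducibility of the n-th cyclotomic polynomial
    makes every 2 + 2 cos(2 pi k / n) with k coprime to n a root of each
    integer polynomial that vanishes at B_n ([root_beraha_conj]).

    A chromatic polynomial has no root in the open interval (0, 1): on it the
    sign is prescribed by the numbers of vertices and components, by deletion
    and contraction ([chromatic_root_notin01]).  The conjugate above lies in (0, 1)
    as soon as n/3 < k < n/2, and a k coprime to n exists in that range unless
    n is 1, 2, 3, 4, 6 or 10 ([exists_coprime_between]): take k next to n/2.
    For n = 10 the only integer in the range is 4.

    Conversely, an integer q >= 0 is a root for the complete graph on q + 1
    vertices, and B_10, a root of x^2 - 5x + 5, is a root for an explicit graph
    on 11 vertices ([b10_quadratic_root]).  This graph consists of three
    networks N_i joined in parallel at two non-adjacent poles.  If N_i has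
    S_i(q) extensions of a colouring of the poles by equal colours, and D_i(q)
    extensions of a colouring by different ones, the chromatic polynomial is
    q * prod S_i + q (q - 1) * prod D_i, which vanishes when the product of the
    ratios S_i / D_i is -(q - 1).  At q = B_10, with phi the golden ratio,
    q - 1, q - 2, q - 3 and q - 4 are phi^2, phi, phi^-1 and -phi^-2.  A
    triangle joined to both poles has ratio (q - 1) / (q - 4) = -phi^4.  A
    4-cycle through one pole, whose opposite vertex is joined to the other, has
    ratio (q - 1) (q - 2)^2 / ((q - 1)^2 + (q - 2)^3) = phi^-1.  One
    triangle and two 4-cycles give -phi^4 * phi^-2 = -phi^2, as needed. *)

(** * Chromatic polynomials on the interval (0, 1) *)

Section Sign.

Variable T : finType.
Implicit Types (A D : seq (T * T)) (d : T * T).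

(** Equality constraints A stand for contracted edges, so that deletion and
    contraction never change the vertex type. *)
Definition colourings A D q : {set {ffun T -> 'I_q}} :=
  [set c : {ffun T -> 'I_q} | all (fun p => c p.1 == c p.2) A &&
                              all (fun p => c p.1 != c p.2) D].

(** The ends of d lie in different components of the graph with edge set A,
    expressed by a cut rather than by the absence of a path: cuts are what the
    proofs below consume and produce. *)
Definition separated A d : bool :=
  [exists g : {ffun T -> bool},
    all (fun p => g p.1 == g p.2) A && (g d.1 != g d.2)].

Lemma separatedP A d :
  reflect (exists2 g : T -> bool, {in A, forall p, g p.1 = g p.2}
                                  & g d.1 && ~~ g d.2)
          (separated A d).
Proof.
apply: (iffP existsP) => [[g /andP[/allP gA gd]]|[g gA gd]].
  exists (fun x => g x == g d.1); last by rewrite eqxx /= eq_sym.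
  by move=> p /gA /eqP ->.
exists [ffun x => g x]; rewrite !ffunE; apply/andP; split.
  by apply/allP => p /gA; rewrite !ffunE => ->.
by case/andP: gd => -> /negbTE ->.
Qed.

(** The colour class of d.1 would be a cut. *)
Lemma unseparated_eq A d q (c : {ffun T -> 'I_q}) : ~~ separated A d ->
  all (fun p => c p.1 == c p.2) A -> c d.1 = c d.2.
Proof.
move=> nsep /allP cA; apply/eqP/negPn/negP => cd; case/negP: nsep.
apply/separatedP; exists (fun x => c x == c d.1).
  by move=> p /cA /eqP ->.
by rewrite eqxx eq_sym.
Qed.

Lemma card_colourings_cons A d D q :
  #|colourings A D q| = (#|colourings (d :: A) D q| + #|colourings A (d :: D) q|)%N.
Proof.
rewrite -(cardsID [set c : {ffun T -> 'I_q} | c d.1 == c d.2]); congr (_ + _)%N.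
  by apply: eq_card => c; rewrite !inE /= andbC andbA.
by apply: eq_card => c; rewrite !inE /= andbCA.
Qed.

(** For a cut g, adding a constant of Z/q to the colours on one side of g keeps
    all the constraints of A and D, and shifts the difference of the colours at
    the two ends of d by that constant.  So each of the q values of this
    difference is taken by equally many colourings. *)
Lemma card_colourings_separated A D d q : separated (A ++ D) d ->
  #|colourings A D q| = (q * #|colourings (d :: A) D q|)%N.
Proof.
case/separatedP => g gAD /andP[gu /negbTE gv].
case: q => [|q].
  by rewrite mul0n; apply: eq_card0 => c; case: (c d.1).
pose shift (p : 'I_q.+1 * {ffun T -> 'I_q.+1}) : {ffun T -> 'I_q.+1} :=
  [ffun x => p.2 x + (if g x then p.1 else 0)].
have shiftAD a c : (shift (a, c) \in colourings A D _) = (c \in colourings A D _).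
  rewrite !inE; congr (_ && _); apply: eq_in_all => p pin; rewrite !ffunE /=.
    by rewrite gAD ?mem_cat ?pin // (inj_eq (addIr _)).
  by rewrite gAD ?mem_cat ?pin ?orbT // (inj_eq (addIr _)).
have -> : colourings A D q.+1 =
    shift @: finset.setX [set: _] (colourings (d :: A) D q.+1).
  apply/setP => c; apply/idP/imsetP => [cAD|[[a c'] /finset.setXP[_ c'AD] ->]].
    (* Undoing this shift makes the colours of the ends of d equal. *)
    pose a := c d.1 - c d.2.
    have ca : c = shift (a, shift (- a, c)).
      by apply/ffunP => x; rewrite !ffunE /=; case: (g x); rewrite ?subrK ?addr0.
    exists (a, shift (- a, c)) => //; apply/finset.setXP.
    split; first by rewrite finset.in_setT.
    move: cAD; rewrite {1}ca shiftAD !inE /= -andbA => ->.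
    by rewrite andbT !ffunE /= gu gv addr0 opprB addrC subrK.
  by rewrite shiftAD; move: c'AD; rewrite !inE /= -andbA => /andP[].
rewrite card_in_imset => [|[a c] [b c'] /finset.setXP[_ cd] /finset.setXP[_ cd']].
  by rewrite cardsX finset.cardsT card_ord.
move=> /ffunP E; move: cd cd'; rewrite !inE /=.
case/andP=> /andP[/eqP cd _] _ /andP[/andP[/eqP cd' _] _].
have Ev := E d.2; have Eu := E d.1; rewrite !ffunE /= gu gv in Eu Ev.
rewrite !addr0 in Ev; rewrite cd cd' Ev in Eu.
have ab : a = b by apply: (addrI (c' d.2 : 'I_q.+1)).
rewrite ab; congr (_, _); apply/ffunP => x.
by have := E x; rewrite !ffunE /= ab => /addIr.
Qed.

(** The number of components of the graph with edge set A: a 2-colouring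
    constant on edges is a choice of a set of components. *)
Definition ncomp A : nat := logn 2 #|colourings A [::] 2|.

Lemma ncomp_cons_separated A d : separated A d -> ncomp A = (ncomp (d :: A)).+1.
Proof.
move=> sAd; rewrite /ncomp (@card_colourings_separated _ _ d) ?cats0 //.
rewrite lognM // ?card_gt0; last first.
apply/finset.set0Pn; exists [ffun => ord0].
by rewrite inE andbT; apply/allP => p _; rewrite !ffunE.
Qed.

Lemma ncomp_cons_unseparated A d : ~~ separated A d -> ncomp (d :: A) = ncomp A.
Proof.
move=> nsep; rewrite /ncomp; congr logn; apply: eq_card => c; rewrite !inE /=.
by rewrite !andbT andb_idl // => /(unseparated_eq nsep) ->.
Qed.

Lemma ncomp_cat_cons A d D : ncomp (A ++ d :: D) = ncomp (d :: A ++ D).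
Proof.
rewrite /ncomp; congr logn; apply: eq_card => c; rewrite !inE !all_cat /=.
by rewrite !andbT andbCA all_cat.
Qed.

(** Induction on D by deletion and contraction, p = p1 - p2 with p1 for D and p2
    for d :: A.  The exponent drops by one under contraction, so the two terms
    have the same sign unless deleting d creates a component.  In that case d
    is a bridge, p1 = X p2, and the factor X - 1 is negative on (0, 1).
    Contraction may turn a constraint of D into a loop and p2 into 0, hence the
    weak inequality; the strict one for p1 restores strictness. *)
Lemma colourings_poly_sign (F : realFieldType) A D :
  exists p : {poly F},
    [/\ forall q : nat, p.[q%:R] = #|colourings A D q|%:R,
        forall x, 0 < x < 1 -> 0 <= (-1) ^+ (ncomp A + ncomp (A ++ D)) * p.[x] &
        forall x, 0 < x < 1 -> {in D, forall d, separated A d} ->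
          0 < (-1) ^+ (ncomp A + ncomp (A ++ D)) * p.[x]].
Proof.
elim: D A => [|d D IH] A.
  have [k kP] := card_equal_on A.
  have pos x : 0 < x < 1 ->
      0 < (-1) ^+ (ncomp A + ncomp (A ++ [::])) * ('X^k).[x] :> F.
    move=> /andP[x0 _]; rewrite cats0 addnn -mul2n exprM sqrrN expr1n expr1n mul1r.
    by rewrite hornerXn exprn_gt0.
  exists 'X^k; split=> [q|x /pos /ltW //|x /pos //].
  rewrite hornerXn -natrX -kP; congr (_%:R).
  by apply: eq_card => c; rewrite !inE andbT.
have [sAd|nAd] := boolP (separated A d); last first.
  exists 0; split=> [q|x _|x _ sD].
  - rewrite horner0 eq_card0 // => c; rewrite !inE /=; apply/negP.
    by case/and3P => cA; rewrite (unseparated_eq nAd cA) eqxx.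
  - by rewrite horner0 mulr0.
  - by move: nAd; rewrite sD ?mem_head.
have [p2 [p2N p2ge p2gt]] := IH (d :: A).
have [sADd|nADd] := boolP (separated (A ++ D) d).
  exists (('X - 1%:P) * p2).
  have E x : (-1) ^+ (ncomp A + ncomp (A ++ d :: D)) * (('X - 1%:P) * p2).[x] =
      (1 - x) * ((-1) ^+ (ncomp (d :: A) + ncomp ((d :: A) ++ D)) * p2.[x]).
    rewrite (ncomp_cons_separated sAd) (ncomp_cat_cons A d D) addSn.
    rewrite /=; move: (ncomp (d :: A) + ncomp (d :: A ++ D))%N => r.
    by rewrite exprS hornerM hornerXsubC; ring.
  split=> [q|x x01|x x01 sD]; rewrite ?E.
  - have := card_colourings_cons A d D q.
    rewrite (card_colourings_separated _ sADd) hornerM p2N hornerXsubC.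
    move=> /(congr1 (fun n => n%:R : F)); rewrite natrM natrD => qN.
    by rewrite mulrBl mul1r qN addrC addKr.
  - by rewrite mulr_ge0 ?p2ge // subr_ge0 ltW //; case/andP: x01.
  - rewrite mulr_gt0 ?p2gt // ?subr_gt0; first by case/andP: x01.
    move=> e eD; have /separatedP[h hA /andP[he1 he2]] : separated A e.
      by apply: sD; rewrite inE eD orbT.
    have [hd|hd] := eqVneq (h d.1) (h d.2).
      apply/separatedP; exists h; rewrite ?he1 // => p.
      by rewrite inE => /predU1P[->//|/hA].
    (* The symmetric difference of the cuts h and g no longer splits d. *)
    have /separatedP[g gAD /andP[gd1 gd2]] := sADd.
    have gA p : p \in A ++ D -> g p.1 = g p.2 by exact: gAD.
    apply/existsP; exists [ffun x => h x (+) g x].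
    rewrite !ffunE (gAD e) ?mem_cat ?eD ?orbT // he1 (negbTE he2).
    rewrite [X in _ && X](_ : _ = true); last by case: (g e.2).
    rewrite andbT; apply/allP => p; rewrite inE !ffunE => /predU1P[->|pA].
      by move: hd; rewrite gd1 (negbTE gd2); do 2 case: (h _).
    by rewrite hA // gA // mem_cat pA.
have [p1 [p1N p1ge p1gt]] := IH A.
exists (p1 - p2).
have E x : (-1) ^+ (ncomp A + ncomp (A ++ d :: D)) * (p1 - p2).[x] =
    (-1) ^+ (ncomp A + ncomp (A ++ D)) * p1.[x] +
    (-1) ^+ (ncomp (d :: A) + ncomp ((d :: A) ++ D)) * p2.[x].
  rewrite -(ncomp_cons_unseparated nADd) (ncomp_cat_cons A d D).
  rewrite (ncomp_cons_separated sAd) /= addSn; move: (ncomp (d :: A) + ncomp (d :: A ++ D))%N => r.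
  by rewrite exprS hornerD hornerN; ring.
split=> [q|x x01|x x01 sD]; rewrite ?E.
- rewrite hornerD hornerN p1N p2N (card_colourings_cons A d D q) natrD; ring.
- by rewrite addr_ge0 ?p1ge ?p2ge.
- rewrite ltr_wpDr ?p2ge ?p1gt // => e eD; apply: sD.
  by rewrite inE eD orbT.
Qed.

End Sign.

Lemma chromatic_root_notin01 (F : realFieldType) (x : F) :
  0 < x < 1 -> ~ chromatic_root x.
Proof.
move=> x01 [G]; pose D := [seq d <- enum {: G * G} | adj d.1 d.2].
have [p [pN _ /(_ x x01) pgt]] := colourings_poly_sign F [::] D.
rewrite -(@chromatic_poly_unique F G p) => [/rootP px|q].
  rewrite px mulr0 ltxx in pgt; suff : false by [].
  apply: pgt => -[u v]; rewrite mem_filter /= => /andP[uv _].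
  apply/separatedP; exists (fun y => y == u) => //=; rewrite eqxx.
  by apply/eqP => vu; rewrite vu adj_irr in uv.
rewrite pN; congr (_%:R); apply: eq_card => c; rewrite !inE /=.
apply/allP/'forall_forallP => [H y z|H [y z]].
  by apply/implyP => yz; apply: (H (y, z)); rewrite mem_filter mem_enum yz.
by rewrite mem_filter => /andP[/= yz _]; apply: (implyP (H y z)).
Qed.

(** * Galois conjugates of Beraha numbers *)

(** Up to the embedding of the rationals, 'Phi_n is the minimal polynomial of an
    algebraic primitive n-th root of unity z; z is a root of one of the factors
    in a product r * q, and minimality makes the other factor constant. *)
Lemma irreducible_Cyclotomic n : (0 < n)%N ->
  irreducible_poly (map_poly intr ('Phi_n) : {poly rat}).
Proof.
move=> n0; have [z zP] := C_prim_root_exists n0.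
have [p [pz _ pmin]] := minCpolyP z.
have pE : p = map_poly intr 'Phi_n.
  apply: (map_inj_poly (fmorph_inj (ratr : rat -> algC)) (rmorph0 _)).
  rewrite -pz (minCpoly_cyclotomic zP) -(Cintr_Cyclotomic zP) -map_poly_comp.
  by apply: eq_map_poly => a /=; rewrite ratr_int.
rewrite -pE; split.
  rewrite pE size_map_inj_poly ?size_Cyclotomic ?ltnS ?totient_gt0 //.
  exact: intr_inj.
move=> q sq /dvdpP[r pr].
have p0 : p != 0.
  apply: contraTneq (minCpoly_monic z); rewrite pz => ->.
  by rewrite rmorph0 monicE lead_coef0 eq_sym oner_eq0.
have : root (map_poly ratr (r * q)) z by rewrite -pr pmin dvdpp.
rewrite rmorphM rootM !pmin => /orP[pdr|]; last first.
  by move=> pq; rewrite /eqp pq andbT pr dvdp_mulIr.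
have [r0 q0] : r != 0 /\ q != 0 by apply/andP; rewrite -negb_or -mulf_eq0 -pr.
have := dvdp_leq r0 pdr; rewrite pr size_mul // => le_r.
have s1 : (0 < size q)%N by rewrite size_poly_gt0.
by exfalso; move: (size q) (size r) sq s1 le_r => a b; lia.
Qed.

Lemma root_map_prod (F : numFieldType) (I : eqType) (s : seq I)
    (f : I -> {poly int}) (z : F) :
  root (map_poly intr (\prod_(i <- s) f i)) z ->
  exists2 i, i \in s & root (map_poly intr (f i)) z.
Proof.
elim: s => [|i s IH]; first by rewrite big_nil rmorph1 (negbTE (root1 _)).
rewrite big_cons rmorphM rootM => /orP[ri|/IH[j js rj]].
  by exists i; rewrite ?mem_head.
by exists j; rewrite // inE js orbT.
Qed.

(** z is a root of X^n - 1, the product of the 'Phi_d for d dividing n; a root of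
    'Phi_d is a d-th root of unity, so that only d = n can occur. *)
Lemma root_Cyclotomic (F : numFieldType) n (z : F) :
  n.-primitive_root z -> root (map_poly intr 'Phi_n) z.
Proof.
move=> zP; have n0 := prim_order_gt0 zP.
have Xn1 m : root (map_poly intr ('X^m - 1 : {poly int})) z = (n %| m)%N.
  rewrite rmorphB rmorph1 /= map_polyXn rootE !hornerE subr_eq0.
  by rewrite (prim_order_dvd zP).
have := dvdnn n; rewrite -{1}Xn1 -(prod_Cyclotomic n0) => /root_map_prod[d].
rewrite -dvdn_divisors // => dn rd; suff -> : n = d by [].
have d0 := dvdn_gt0 n0 dn.
apply/eqP; rewrite eqn_dvd dn andbT -Xn1 -(prod_Cyclotomic d0).
by rewrite (bigD1_seq d) ?divisors_uniq ?divisors_id //= rmorphM rootM rd.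
Qed.

(** 'Phi_n vanishes at z and at z ^+ k.  It is irreducible and has the root z in
    common with p, so it divides p. *)
Lemma root_expr_coprime (F : numFieldType) (p : {poly int}) n k (z : F) :
  n.-primitive_root z -> coprime k n ->
  root (map_poly intr p) z -> root (map_poly intr p) (z ^+ k).
Proof.
move=> zP kn rz; have n0 := prim_order_gt0 zP.
have zkP : n.-primitive_root (z ^+ k) by rewrite prim_root_exp_coprime.
have ratE (q : {poly int}) :
    map_poly intr q = map_poly ratr (map_poly intr q) :> {poly F}.
  by rewrite -map_poly_comp; apply: eq_map_poly => a /=; rewrite ratr_int.
have [dvd|ndvd] := boolP (map_poly intr 'Phi_n %| (map_poly intr p : {poly rat})).
  have := root_Cyclotomic zkP; rewrite !ratE -!dvdp_XsubCl => /dvdp_trans; apply.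
  by rewrite dvdp_map.
have cop : coprimep (map_poly intr 'Phi_n) (map_poly intr p : {poly rat}).
  rewrite irreducible_poly_coprime //; exact: irreducible_Cyclotomic.
have : coprimep (map_poly intr 'Phi_n) (map_poly intr p : {poly F}).
  by rewrite !ratE coprimep_map.
by move/coprimep_root => /(_ z (root_Cyclotomic zP)); rewrite -rootE rz.
Qed.

Section Conj.
Variable R : realType.
Local Open Scope complex_scope.

Definition cis (t : R) : R[i] := cos t +i* sin t.

Lemma cisD s t : cis (s + t) = cis s * cis t.
Proof. by rewrite /cis cosD sinD; simpc; congr (_ +i* _); ring. Qed.

Lemma cisMn t k : cis (t *+ k) = cis t ^+ k.
Proof.
elim: k => [|k IH]; first by rewrite mulr0n /cis cos0 sin0.
by rewrite mulrSr cisD IH exprSr.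
Qed.

(** If the order m of this root of unity were less than n, then
    cos (2 pi m / n) = 1 - 2 sin^2 (pi m / n) would be less than 1. *)
Lemma cis_prim_root n : (0 < n)%N -> n.-primitive_root (cis (2 * pi / n%:R)).
Proof.
move=> n0; have n0R : n%:R != 0 :> R by rewrite pnatr_eq0 -lt0n.
have nR : 0 < n%:R :> R by rewrite ltr0n.
have piR : 0 < pi :> R := pi_gt0 R.
have zn : cis (2 * pi / n%:R) ^+ n = 1.
  rewrite -cisMn -[_ *+ n]mulr_natr divfK // mulrC mulr_natr.
  by rewrite /cis cos2pi sin2pi.
have [m zP mn] := prim_order_exists n0 zn.
suff E : m = n by rewrite E in zP.
apply/eqP/negPn/negP => nm.
have m_lt : (m < n)%N by rewrite ltn_neqAle nm dvdn_leq.
have m0 := prim_order_gt0 zP.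
pose t : R := pi * m%:R / n%:R.
have t_itv : 0 < t < pi.
  rewrite divr_gt0 ?mulr_gt0 ?ltr0n //= ltr_pdivrMr // ltr_pM2l //.
  by rewrite ltr_nat.
have : cos (t + t) = 1.
  have := prim_expr_order zP; rewrite -cisMn => -[+ _].
  by congr (cos _ = 1); rewrite -[_ *+ m]mulr_natr /t; field.
rewrite cosD => c1; have := sin_gt0_pi t_itv; have := cos2Dsin2 t.
nra.
Qed.

(** Substituting 2 + X + X^(n-1) turns p into an integer polynomial q with
    q(z^j) = p(2 + z^j + z^-j) for every n-th root of unity z. *)
Lemma root_beraha_conj (p : {poly int}) n k : (0 < n)%N -> coprime k n ->
  root (map_poly intr p) (beraha R n) ->
  root (map_poly intr p) (2 + 2 * cos (2 * pi / n%:R *+ k : R)).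
Proof.
move=> n0 kn; set t : R := 2 * pi / n%:R.
have zP := cis_prim_root n0; rewrite -/t in zP.
pose q := p \Po (2%:P + 'X + 'X^(n.-1)).
have qE j : root (map_poly intr q) (cis t ^+ j) =
            root (map_poly intr p) (2 + 2 * cos (t *+ j)).
  rewrite map_comp_poly rootE horner_comp !rmorphD /= map_polyX map_polyXn.
  rewrite map_polyC /= !hornerE.
  have -> : cis t ^+ j ^+ n.-1 = cis (- (t *+ j)).
    apply: (mulfI (_ : cis t ^+ j != 0)).
      apply/expf_neq0/eqP => z0; move/eqP: (prim_expr_order zP).
      by rewrite z0 expr0n gtn_eqF // eq_sym oner_eq0.
    rewrite -exprS prednK // exprAC (prim_expr_order zP) expr1n.
    by rewrite -cisMn -cisD subrr /cis cos0 sin0.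
  have -> : 2%:~R + cis t ^+ j + cis (- (t *+ j)) =
            real_complex R (2 + 2 * cos (t *+ j)).
    rewrite -cisMn /cis cosN sinN.
    by simpc; congr (_ +i* _); ring.
  have -> : map_poly intr p = map_poly (real_complex R) (map_poly intr p).
    by rewrite -map_poly_comp; apply: eq_map_poly => a /=; rewrite rmorph_int.
  by rewrite horner_map fmorph_eq0.
have := root_expr_coprime (p := q) zP kn.
by rewrite -{1}[cis t]expr1 !qE mulr1n.
Qed.

End Conj.

(** * Values of Beraha numbers *)

Section Values.
Variable R : realType.

Lemma beraha1 : beraha R 1 = 4.
Proof. by rewrite /beraha divr1 [2 * pi]mulr_natl cos2pi; ring. Qed.

Lemma beraha2 : beraha R 2 = 0.
Proof. by rewrite /beraha [2 * pi]mulrC mulfK ?pnatr_eq0 // cospi; ring. Qed.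

Lemma beraha4 : beraha R 4 = 2.
Proof.
rewrite /beraha (_ : 2 * pi / 4 = pi / 2); last by field.
by rewrite cos_pihalf; ring.
Qed.

Lemma cos2x (t : R) : cos (2 * t) = 2 * cos t ^+ 2 - 1.
Proof. by rewrite [2 * t]mulr_natl mulr2n cosD -!expr2 sin2cos2; ring. Qed.

Lemma cos3x (t : R) : cos (3 * t) = 4 * cos t ^+ 3 - 3 * cos t.
Proof.
have -> : 3 * t = t + t + t by ring.
rewrite !cosD sinD.
rewrite (_ : _ - _ = cos t ^+ 3 - 3 * cos t * sin t ^+ 2); last by ring.
by rewrite sin2cos2; ring.
Qed.

Lemma cos_pi_div_gt0 m : 2 < m -> 0 < cos (pi / m : R).
Proof.
move=> m2; have piR := pi_gt0 R; have m0 : 0 < m by lra.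
apply: cos_gt0_pihalf; apply/andP; split.
  by rewrite (@lt_trans _ _ 0) ?divr_gt0 // oppr_lt0 divr_gt0.
by rewrite ltr_pM2l // ltf_pV2 ?posrE.
Qed.

(** The angle t = pi / 3 satisfies cos (2 t) = - cos t, that is
    (cos t + 1) (2 cos t - 1) = 0. *)
Lemma cos_pi3 : cos (pi / 3) = 1 / 2 :> R.
Proof.
have c0 : 0 < cos (pi / 3 : R) by apply: cos_pi_div_gt0; lra.
have : cos (2 * (pi / 3)) = - cos (pi / 3) :> R.
  by rewrite -[in RHS]cosN -cosDpi; congr cos; field.
rewrite cos2x; nra.
Qed.

(** The angle t = pi / 5 satisfies cos (3 t) = - cos (2 t), that is
    (cos t + 1) (4 cos^2 t - 2 cos t - 1) = 0. *)
Lemma cos_pi5 : cos (pi / 5) = (1 + Num.sqrt 5) / 4 :> R.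
Proof.
have c0 : 0 < cos (pi / 5 : R) by apply: cos_pi_div_gt0; lra.
have s5 : Num.sqrt 5 ^+ 2 = 5 :> R by rewrite sqr_sqrtr.
have s0 : 0 <= Num.sqrt 5 :> R by exact: sqrtr_ge0.
have : cos (3 * (pi / 5)) = - cos (2 * (pi / 5)) :> R.
  by rewrite -[in RHS]cosN -cosDpi; congr cos; field.
rewrite cos3x cos2x; move: (cos _) (Num.sqrt _) c0 s5 s0 => c s c0 s5 s0 E.
have /eqP : (c + 1) * ((4 * c - 1 - s) * (4 * c - 1 + s)) = 0 by nra.
rewrite !mulf_eq0 => /or3P[] /eqP; nra.
Qed.

Lemma beraha3 : beraha R 3 = 1.
Proof.
by rewrite /beraha -mulrA cos2x cos_pi3; field.
Qed.

Lemma beraha6 : beraha R 6 = 3.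
Proof.
rewrite /beraha (_ : 2 * pi / 6 = pi / 3); last by field.
by rewrite cos_pi3; field.
Qed.

Lemma beraha10 : beraha R 10 = (5 + Num.sqrt 5) / 2.
Proof.
rewrite /beraha (_ : 2 * pi / 10 = pi / 5); last by field.
by rewrite cos_pi5; field.
Qed.

(** The angle lies strictly between 2 pi / 3 and pi. *)
Lemma galois_conj_itv n k : (n < 3 * k)%N -> (2 * k < n)%N ->
  0 < 2 + 2 * cos (2 * pi / n%:R *+ k : R) < 1.
Proof.
move=> n3k k2n; have piR := pi_gt0 R.
have n0 : 0 < n%:R :> R by rewrite ltr0n; lia.
have nN0 := lt0r_neq0 n0.
have c23 : cos (2 * (pi / 3)) = - (1 / 2) :> R.
  by rewrite cos2x cos_pi3; field.
set t : R := _ *+ k.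
have tE : t = pi * ((2 * k)%N%:R / n%:R).
  by rewrite /t -[_ *+ k]mulr_natr natrM; field.
have [t_gt t_lt] : 2 * (pi / 3) < t /\ t < pi.
  split.
    rewrite (_ : 2 * _ = pi * (2 / 3)); last by field.
    rewrite tE ltr_pM2l // ltr_pdivlMr // mulrAC ltr_pdivrMr //.
    by rewrite -!natrM ltr_nat; lia.
  by rewrite tE gtr_pMr // ltr_pdivrMr // mul1r ltr_nat.
have := @ltr_cos R (2 * (pi / 3)) t; have := @ltr_cos R t pi.
rewrite !in_itv /= cospi c23 t_lt t_gt.
have -> : 0 <= t <= pi by apply/andP; split; lra.
have -> : 0 <= @pi R <= @pi R by apply/andP; split; lra.
have -> : 0 <= 2 * (@pi R / 3) <= @pi R by apply/andP; split; lra.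
by move=> /(_ isT isT) ? /(_ isT isT) ?; apply/andP; split; lra.
Qed.

End Values.

(** The integer k below n / 2 closest to it and coprime to n: k is n/2 - 1/2,
    n/2 - 1 or n/2 - 2 for n odd, n = 0 or n = 2 modulo 4, and it exceeds n/3
    except for the listed n. *)
Lemma exists_coprime_between n : (0 < n)%N -> n \notin [:: 1; 2; 3; 4; 6; 10]%N ->
  exists k, [/\ coprime k n, (n < 3 * k)%N & (2 * k < n)%N].
Proof.
move=> n0; rewrite !inE !negb_or => nN.
have odd2 j : coprime (2 * j + 1) 2 by rewrite coprimen2 oddD oddM.
have odd4 j : coprime (2 * j + 1) 4 by rewrite -[4%N]/(2 ^ 2)%N coprimeXr.
have [j [nE|nE|nE]] : exists j, [\/ n = 2 * j + 1, n = 4 * j + 4 | n = 4 * j + 6]%N.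
  case: (boolP (odd n)) => no.
    exists n./2; apply: Or31; lia.
  case: (boolP (odd n./2)) => no2; last by exists (n./2./2).-1; apply: Or32; lia.
  exists (n./2./2).-1; apply: Or33; lia.
- exists j; split; try lia.
  by rewrite nE /coprime gcdnMDl gcdn1.
- exists (2 * j + 1)%N; split; try lia.
  rewrite nE (_ : 4 * j + 4 = 2 * (2 * j + 1) + 2)%N; last by lia.
  by rewrite /coprime gcdnMDl; apply: odd2.
- exists (2 * j + 1)%N; split; try lia.
  rewrite nE (_ : 4 * j + 6 = 2 * (2 * j + 1) + 4)%N; last by lia.
  by rewrite /coprime gcdnMDl; apply: odd4.
Qed.

(** * Integer chromatic roots *)

(** The complete graph on q + 1 vertices has no proper q-colouring. *)
Lemma chromatic_root_nat (F : numFieldType) (q : nat) : chromatic_root (q%:R : F).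
Proof.
have sym : symmetric (fun x y : 'I_q.+1 => x != y) by move=> x y; rewrite eq_sym.
have irr : irreflexive (fun x y : 'I_q.+1 => x != y) by move=> x; rewrite eqxx.
exists (SimpleGraph sym irr); rewrite rootE.
rewrite -[q%:R](rmorph_nat (intr : int -> F)) horner_map /= natz chromatic_polyE.
rewrite /num_colourings eq_card0 // => c; rewrite !inE; apply/negP.
move=> /'forall_forallP cP.
have /leq_card : injective c.
  by move=> x y cxy; apply/eqP/negPn/negP => /(implyP (cP x y)); rewrite cxy eqxx.
by rewrite !card_ord ltnn.
Qed.

(** * A graph with B_10 as a chromatic root *)

(** The graph on 0, ..., n - 1 given by listing, for each vertex, its neighbours
    among the earlier vertices. *)
Definition back_adj (nbs : seq (seq nat)) : rel 'I_(size nbs) :=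
  fun x y => (x < y)%N && (val x \in nth [::] nbs y)
          || (y < x)%N && (val y \in nth [::] nbs x).

Arguments back_adj : clear implicits.

Lemma back_adj_sym nbs : symmetric (back_adj nbs).
Proof. by move=> x y; rewrite /back_adj orbC. Qed.

Lemma back_adj_irr nbs : irreflexive (back_adj nbs).
Proof. by move=> x; rewrite /back_adj ltnn. Qed.

Definition back_graph nbs : simple_graph :=
  SimpleGraph (@back_adj_sym nbs) (@back_adj_irr nbs).

Definition fresh (C : eqType) (nb : seq nat) (w : seq C) (a : C) : bool :=
  all (fun j => onth w j != Some a) nb.

(** For s of the same length as nbs: s extends the colouring w of the first
    vertices to a proper colouring, nbs being the lists of earlier neighbours of
    the remaining vertices. *)
Fixpoint completion q (nbs : seq (seq nat)) (w s : seq 'I_q) : bool :=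
  match nbs, s with
  | nb :: nbs', a :: s' => fresh nb w a && completion nbs' (rcons w a) s'
  | _, _ => true
  end.

Fixpoint completions q (nbs : seq (seq nat)) (w : seq 'I_q) : nat :=
  if nbs is nb :: nbs' then
    (\sum_(a : 'I_q | fresh nb w a) completions nbs' (rcons w a))%N
  else 1%N.

(** Enumerates the ways to extend a partition of the first vertices into k
    independent sets, given by the list l of the block numbers, to a partition
    of all vertices; each way is recorded by the number of blocks it adds. *)
Fixpoint new_blocks (nbs : seq (seq nat)) (l : seq nat) (k : nat) : seq nat :=
  if nbs is nb :: nbs' then
    flatten [seq new_blocks nbs' (rcons l i) k | i <- iota 0 k & fresh nb l i]
    ++ [seq m.+1 | m <- new_blocks nbs' (rcons l k) k.+1]
  else [:: 0%N].

Lemma sum_tupleS (T : finType) n (F : n.+1.-tuple T -> nat) :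
  (\sum_t F t = \sum_(a : T) \sum_(t : n.-tuple T) F [tuple of a :: t])%N.
Proof.
rewrite pair_big /=; apply: (reindex (fun p : T * n.-tuple T => [tuple of p.1 :: p.2])).
exists (fun t => (thead t, [tuple of behead t])) => [[a t] _|t _].
  by congr (_, _); apply: val_inj.
by rewrite /= -tuple_eta.
Qed.

Lemma completionsE q nbs (w : seq 'I_q) :
  completions nbs w = (\sum_(t : (size nbs).-tuple 'I_q) completion nbs w t)%N.
Proof.
elim: nbs w => [|nb nbs IH] w /=.
  by rewrite (big_pred1 [tuple]) // => t; rewrite [t]tuple0; apply/esym/eqP/val_inj.
rewrite sum_tupleS big_mkcond; apply: eq_bigr => a _ /=.
by case: fresh => /=; [exact: IH | rewrite big1].
Qed.

Lemma completionP q nbs (w s : seq 'I_q) : size s = size nbs ->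
  reflect (forall i j, (i < size nbs)%N -> (j < size w + i)%N ->
             j \in nth [::] nbs i -> onth (w ++ s) j != onth s i)
          (completion nbs w s).
Proof.
elim: nbs w s => [|nb nbs IH] w [|a s] //=; first by left.
move=> [/IH{}IH].
apply: (iffP andP) => [[/allP wa ws] [|i] j|H].
- rewrite addn0 /= => _ ij jn.
  by have := wa j jn; rewrite onth_cat ij.
- move=> im ij jn /=; rewrite -cat_rcons; move/IH: ws; apply => //.
  by rewrite size_rcons addSnnS.
split; last first.
  apply/IH => i j im ij jn; rewrite cat_rcons; apply: (H i.+1) => //.
  by rewrite size_rcons addSnnS in ij.
apply/allP => j jn; case: (ltnP j (size w)) => jw; last by rewrite onth_default.
by have := H 0%N j isT; rewrite addn0 onth_cat jw; apply.
Qed.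

Lemma num_colourings_back_graph nbs q :
  num_colourings (back_graph nbs) q = @completions q nbs [::].
Proof.
rewrite completionsE /num_colourings -sum1dep_card big_mkcond /=.
pose h (t : (size nbs).-tuple 'I_q) : {ffun 'I_(size nbs) -> 'I_q} :=
  [ffun i => tnth t i].
rewrite (reindex h) /=; last first.
  exists (fun c => [tuple c i | i < size nbs]) => [t _|c _].
    by apply: eq_from_tnth => i; rewrite tnth_mktuple ffunE.
  by apply/ffunP => i; rewrite ffunE tnth_mktuple.
apply: eq_bigr => t _.
have onthE (i : 'I_(size nbs)) : onth t i = Some (h t i).
  by rewrite seq.onthE (nth_map (tnth t i)) ?size_tuple // -tnth_nth ffunE.
suff -> : proper_colouring (G := back_graph nbs) (h t) = completion nbs [::] t.
  by case: completion.
apply/'forall_forallP/completionP; rewrite ?size_tuple // => H.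
  move=> i j im; rewrite add0n /= => ij jn.
  have jm := ltn_trans ij im.
  have := H (Ordinal jm) (Ordinal im); rewrite /= /back_adj /= ij jn /=.
  by rewrite (onthE (Ordinal jm)) (onthE (Ordinal im)).
move=> x y; apply/implyP => /orP[] /andP[xy xin].
  by have := H y x (ltn_ord y) xy xin; rewrite /= !onthE.
by have := H x y (ltn_ord x) xy xin; rewrite /= !onthE eq_sym.
Qed.

Lemma fresh_map (C D : eqType) (f : C -> D) nb (l : seq C) i :
  {in l, forall j, f j = f i -> j = i} -> fresh nb (map f l) (f i) = fresh nb l i.
Proof.
move=> finj; apply: eq_all => j; rewrite onth_map.
case E: (onth l j) => [b|] //=; congr (~~ _).
apply/eqP/eqP => [[]|[->]//].
have bl : b \in l by apply/onthP; exists j.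
by move/(finj _ bl) => ->.
Qed.

(** A colouring amounts to the partition into its colour classes and an
    injection of the classes into the colours.  The next vertex reuses one of the
    k colours in use or takes one of the q - k others, all of which lead to the
    same partition. *)
Lemma completions_new_blocks q nbs (f : nat -> 'I_q) (l : seq nat) k :
  {in gtn k &, injective f} -> {subset l <= gtn k} ->
  completions nbs (map f l) =
  (\sum_(m <- new_blocks nbs l k) (q - k) ^_ m)%N.
Proof.
elim: nbs f l k => [|nb nbs IH] f l k finj lk /=; first by rewrite big_seq1.
set used := [seq f i | i <- iota 0 k].
have used_uniq : uniq used.
  rewrite map_inj_in_uniq ?iota_uniq // => i j.
  by rewrite !mem_iota !add0n /=; apply: finj.
(* Colours in use correspond to old blocks, the others to a new block. *)
rewrite (bigID (fun a => a \in used)) /= big_cat /=; congr (_ + _)%N.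
  rewrite (eq_bigl (fun a => (a \in used) && fresh nb (map f l) a)); last first.
    by move=> a; rewrite andbC.
  rewrite -big_filter_cond -[X in (\sum_(a <- X | _) _)%N]/(filter _ _).
  rewrite (perm_big used) /=; last first.
    apply: uniq_perm => // [|a]; first by rewrite filter_uniq ?index_enum_uniq.
    by rewrite mem_filter mem_index_enum andbT.
  rewrite big_map big_flatten /= big_map big_filter.
  rewrite big_seq_cond [RHS]big_seq_cond.
  apply: eq_big => i.
    case: (boolP (i \in iota 0 k)) => //=; rewrite mem_iota add0n /= => ik.
    by apply: fresh_map => j /lk jk; apply: finj.
  rewrite mem_iota add0n /= => /andP[ik _]; rewrite -map_rcons; apply: IH => // j.
  by rewrite mem_rcons inE => /predU1P[->//|/lk].
rewrite big_map.
under [RHS]eq_bigr do rewrite ffactnS -subnS.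
rewrite -big_distrr /=.
have <- : #|[pred a | a \notin used]| = (q - k)%N.
  have := cardC (mem used); rewrite card_ord (card_uniqP used_uniq).
  rewrite size_map size_iota => /(canRL (addKn k)) <-.
  exact: eq_card.
rewrite -sum_nat_const; apply: eq_big => [a|a /andP[_ aN]].
  rewrite inE andb_idl // => aN; apply/allP => j _; rewrite onth_map.
  case E: (onth l j) => [b|] //=; apply: contra aN => /eqP[<-].
  have /lk bk : b \in l by apply/onthP; exists j.
  by apply: map_f; rewrite mem_iota.
pose g i := if i == k then a else f i.
have gf : {in gtn k, g =1 f} by move=> i; rewrite inE /g => /ltn_eqF ->.
have -> : rcons [seq f i | i <- l] a = [seq g i | i <- rcons l k].
  rewrite map_rcons {2}/g eqxx; congr rcons.
  by apply/eq_in_map => i /lk /gf.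
have fN i : (i < k)%N -> f i <> a.
  by move=> ik E; move: aN; rewrite -E map_f // mem_iota.
apply: IH => [i j|i].
  rewrite !inE !ltnS /g => ik jk.
  case: eqP => [->|/eqP iN]; case: eqP => [->|/eqP jN] //.
  - by move/esym; case/(fN j); rewrite ltn_neqAle jN.
  - by case/(fN i); rewrite ltn_neqAle iN.
  by apply: finj; rewrite inE ltn_neqAle ?iN ?jN.
by rewrite mem_rcons !inE => /predU1P[->|/lk]; rewrite ?ltnS // => /ltnW.
Qed.

Lemma num_colourings_new_blocks nbs q :
  num_colourings (back_graph nbs) q =
  (\sum_(m <- new_blocks nbs [::] 0) q ^_ m)%N.
Proof.
rewrite num_colourings_back_graph; case: q => [|q].
  case: nbs => [|nb nbs] /=; first by rewrite big_seq1.
  by rewrite big_ord0 big_map big1.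
rewrite (@completions_new_blocks _ _ (fun=> ord0) [::] 0) ?subn0 // => i j.
Qed.

(** Also for m > q: both sides then vanish. *)
Lemma natr_ffact (F : comNzRingType) q m :
  (q ^_ m)%:R = \prod_(i < m) (q%:R - i%:R) :> F.
Proof.
elim: m => [|m IH]; first by rewrite big_ord0.
rewrite big_ord_recr -IH ffactnSr natrM /=.
case: (leqP m q) => [mq|qm]; first by rewrite natrB.
by rewrite ffact_small // !mul0r.
Qed.

(** The expansion of the chromatic polynomial in falling factorials. *)
Lemma root_back_graph (F : numFieldType) nbs (x : F) :
  \sum_(m <- new_blocks nbs [::] 0) \prod_(i < m) (x - i%:R) = 0 ->
  root (map_poly intr (chromatic_poly (back_graph nbs))) x.
Proof.
move=> x0; rewrite rootE.
pose p : {poly F} :=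
  \sum_(m <- new_blocks nbs [::] 0) \prod_(i < m) ('X - (i%:R)%:P).
have pE y : p.[y] = \sum_(m <- new_blocks nbs [::] 0) \prod_(i < m) (y - i%:R).
  rewrite horner_sum; apply: eq_bigr => m _.
  by rewrite horner_prod; apply: eq_bigr => i _; rewrite !hornerE.
rewrite -(@chromatic_poly_unique F (back_graph nbs) p) ?pE ?x0 // => q.
rewrite pE num_colourings_new_blocks natr_sum.
by apply: eq_bigr => m _; rewrite natr_ffact.
Qed.

Lemma sum_count_mem (V : nmodType) n (s : seq nat) (F : nat -> V) :
  all (gtn n) s ->
  \sum_(m <- s) F m = \sum_(m < n) F m *+ count_mem (val m) s.
Proof.
elim: s => [|a s IH] /=; first by rewrite big_nil big1.
case/andP=> an /IH{}IH; rewrite big_cons IH.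
under [RHS]eq_bigr do rewrite mulrnDr.
rewrite big_split; congr (_ + _).
rewrite (bigD1 (Ordinal an)) //= eqxx big1 ?addr0 // => i ia.
by rewrite -val_eqE /= eq_sym in ia; rewrite (negbTE ia).
Qed.

(** The poles are 0 and 1, the triangle is 2, 3, 4, and the 4-cycles through
    pole 0 are 0, 6, 5, 7 and 0, 9, 8, 10, with 5 and 8 joined to pole 1. *)
Definition b10_nbs : seq (seq nat) :=
  [:: [::]; [::]; [:: 0; 1]; [:: 0; 1; 2]; [:: 0; 1; 2; 3];
      [:: 1]; [:: 0; 5]; [:: 0; 5]; [:: 1]; [:: 0; 8]; [:: 0; 8]]%N.

(** The number of partitions of the vertices into m independent sets, for m < 12.
    The entries 8048 and 7138 are written as products because a numeral above 5000
    is not read as an iterated successor, which [ring] needs. *)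
Lemma b10_blocks :
  all (gtn 12) (new_blocks b10_nbs [::] 0) &&
  ([seq count_mem m (new_blocks b10_nbs [::] 0) | m <- iota 0 12] ==
    [:: 0; 0; 0; 0; 144; 3001; 2 * 4024; 2 * 3569; 2682; 464; 36; 1])%N.
Proof. by vm_compute. Qed.

(** After the factor x (x - 1) (x - 2) (x - 3), the two summands of the first
    factorization count the colourings with equal and with different colours at
    the poles; the second one exhibits the quadratic factor. *)
Lemma b10_quadratic_root (F : numFieldType) (x : F) :
  x ^+ 2 - 5 * x + 5 = 0 ->
  root (map_poly intr (chromatic_poly (back_graph b10_nbs))) x.
Proof.
move=> x0; apply: root_back_graph.
move: (new_blocks b10_nbs [::] 0) b10_blocks => s /andP[s12 /eqP cnt].
rewrite (sum_count_mem _ s12).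
pose c m := count_mem m s; pose ff m := \prod_(i < m) (x - i%:R).
have ff0 : ff 0%N = 1 by rewrite /ff big_ord0.
have ffS m : ff m.+1 = ff m * (x - m%:R) by rewrite /ff big_ord_recr.
rewrite -[LHS]/(\sum_(m < 12) ff m *+ c m).
rewrite -[LHS]/(map c (iota 0 12)) in cnt.
clearbody ff c; rewrite !big_ord_recr big_ord0 /= !ffS ff0; case: cnt.
do 12 move=> ->.
transitivity (x * (x - 1) * (x - 2) * (x - 3) *
  ((x - 1) ^+ 2 * (x - 2) ^+ 4 + (x - 4) * ((x - 1) ^+ 2 + (x - 2) ^+ 3) ^+ 2)).
  ring.
transitivity (x * (x - 1) * (x - 2) * (x - 3) * (x ^+ 2 - 5 * x + 5) *
  (x ^+ 5 - 8 * x ^+ 4 + 30 * x ^+ 3 - 63 * x ^+ 2 + 73 * x - 36)).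
  ring.
by rewrite x0 mulr0 mul0r.
Qed.

Theorem proposition1p1 (R : realType) :
  ([/\ beraha R 1 = 4, beraha R 2 = 0, beraha R 3 = 1, beraha R 4 = 2
     & beraha R 6 = 3] /\
   beraha R 10 = (5 + Num.sqrt 5) / 2) /\
  [set x : R | (exists2 n : nat, (1 <= n)%N & x = beraha R n) /\
               chromatic_root x] =
  [set beraha R 1; beraha R 2; beraha R 3; beraha R 4; beraha R 6;
       beraha R 10].
Proof.
have values := (beraha1 R, beraha2 R, beraha3 R, beraha4 R, beraha6 R).
split; first by split; [rewrite !values | exact: beraha10].
apply/seteqP; split=> x /=.
  case=> -[n n0 ->] [G].
  have [n_in _|n_notin] := boolP (n \in [:: 1; 2; 3; 4; 6; 10]%N).
    by move: n_in; rewrite !inE => /or4P[||| /or3P[]] /eqP->; tauto.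
  have [k [kn n3k k2n]] := exists_coprime_between n0 n_notin.
  move=> /(root_beraha_conj n0 kn) kroot.
  by case: (chromatic_root_notin01 (galois_conj_itv R n3k k2n)); exists G.
case=> [[[[[]|]|]|]|] ->; (split; first by eexists; last reflexivity).
- by rewrite beraha1; apply: (chromatic_root_nat R 4).
- by rewrite beraha2; apply: (chromatic_root_nat R 0).
- by rewrite beraha3; apply: (chromatic_root_nat R 1).
- by rewrite beraha4; apply: (chromatic_root_nat R 2).
- by rewrite beraha6; apply: (chromatic_root_nat R 3).
exists (back_graph b10_nbs); apply: b10_quadratic_root.
have s5 : Num.sqrt 5 ^+ 2 = 5 :> R by rewrite sqr_sqrtr.
by rewrite beraha10; move: (Num.sqrt _) s5 => s s5; nra.
Qed.
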